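(* Let $(X,d,\mu)$, $\Omega$, $\theta\in[0,1)$, the boundary measure $\mathscr H$ on $\partial\Omega$, the double-phase function $\mathcal H$, the trace operator $T$ and the functional $\mathcal J_f$ be as in the context, where $\Omega$ is bounded, $\mathcal H$ satisfies the local comparability condition on $\overline\Omega$, and $\Omega$ supports the weak $(1,1)$-Poincaré inequality. Let $f\in L^{\widetilde{\mathcal H}}(\partial\Omega)$ satisfy $\int_{\partial\Omega}f\,d\mathscr H=0$, let $I(f)=\inf_{u\in N^{1,\mathcal H}_*(\Omega)}\mathcal J_f(u)$, and let $$\mathcal M:=\{u\in N^{1,\mathcal H}_*(\Omega):\mathcal J_f(u)=I(f)\}.$$ If $u,v\in\mathcal M$, then $g_u=g_v$ $\mu$-a.e. in $\Omega$, where $g_u,g_v$ are the minimal $\mathcal H$-weak upper gradients of $u,v$.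
   Context: Setting. $(X,d,\mu)$ is a complete metric measure space, where $\mu$ is a $\sigma$-finite Borel regular measure with $0<\mu(B(x,r))<\infty$ for every open ball. $\Omega\subset X$ is a domain such that $0<\mu(B(x,r)\cap\Omega)<\infty$ for all $x\in\overline\Omega$, $r>0$, and $\mu$ satisfies the restricted doubling condition on $\Omega$: there is $C\ge1$ with $\mu(B(x,2r)\cap\Omega)\le C\mu(B(x,r)\cap\Omega)$ for all $x\in\overline\Omega$, $r>0$. $\mathscr H$ is a $\sigma$-finite Borel regular measure on $\partial\Omega$ satisfying, for a fixed $0\le\theta<1$, the upper codimension-$\theta$ condition: there is $C_\theta>0$ with $\mathscr H(B(x,r)\cap\partial\Omega)\le C_\theta\, r^{-\theta}\mu(B(x,r)\cap\Omega)$ for all $x\in\partial\Omega$, $r>0$. Double-phase function. $\mathcal H(x,\xi)=\xi^{p(x)}+a(x)\xi^{q(x)}$ for $x\in\overline\Omega$, $\xi\ge0$, where $p,q,a$ are measurable on $\overline\Omega$, $1<p(x)<q(x)<\infty$ for all $x$, $1<p^-:=\operatorname{ess\,inf}p\le p^+:=\operatorname{ess\,sup}p<\infty$, $1<q^-:=\operatorname{ess\,inf}q\le q^+:=\operatorname{ess\,sup}q<\infty$, and $0\le a\in L^\infty$. These conditions are assumed on $\overline\Omega$ with respect to $\mu$, and on $\partial\Omega$ with respect to $\mathscr H$. The complementary function is $\widetilde{\mathcal H}(x,\xi)=\sup_{s\ge0}\{s\xi-\mathcal H(x,s)\}$. Spaces. $L^{\mathcal H}(\Omega)$ is the space of measurable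 $u$ on $\Omega$ with $\varrho_{\mathcal H}(u)=\int_\Omega\mathcal H(x,|u|)\,d\mu<\infty$, with Luxemburg norm $\|u\|=\inf\{\tau>0:\varrho_{\mathcal H}(u/\tau)\le1\}$; $L^{\mathcal H}(\partial\Omega)$ and $L^{\widetilde{\mathcal H}}(\partial\Omega)$ are defined in the same way on $\partial\Omega$ with measure $\mathscr H$ and functions $\mathcal H$, $\widetilde{\mathcal H}$ respectively. Rectifiable curves are nonconstant, continuous, of finite length $\ell_\gamma$ and parametrized on $[0,\ell_\gamma]$. The $\mathcal H$-modulus of a family $\Gamma$ of rectifiable curves in $\Omega$ is $\inf\int_\Omega\mathcal H(x,h)\,d\mu$ over Borel $h\ge0$ (values in $[0,\infty]$) with $\int_\gamma h\,ds\ge1$ for all $\gamma\in\Gamma$ ($\infty$ if there is no such $h$). A nonnegative Borel function $g$ on $\Omega$ is an $\mathcal H$-weak upper gradient of a measurable $u:\Omega\to[-\infty,\infty]$ if $|u(\gamma(0))-u(\gamma(\ell_\gamma))|\le\int_\gamma g\,ds$ for all rectifiable curves $\gamma$ in $\Omega$ outside a family of $\mathcal H$-modulus zero (with $|(\pm\infty)-(\pm\infty)|=\infty$). If $u$ has an $\mathcal H$-weak upper gradient in $L^{\mathcal H}(\Omega)$, then $g_u$ denotes the minimal one ($g_u\le g$ $\mu$-a.e. for every $\mathcal H$-weak upper gradient $g\in L^{\mathcal H}(\Omega)$ of $u$), which exists and is $\mu$-a.e. unique. $N^{1,\mathcal H}(\Omega)$ is the (Banach) space of everywhere-defined $u\in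 L^{\mathcal H}(\Omega)$ having an $\mathcal H$-weak upper gradient in $L^{\mathcal H}(\Omega)$, with norm $\|u\|_{N^{1,\mathcal H}(\Omega)}=\|u\|_{L^{\mathcal H}(\Omega)}+\|g_u\|_{L^{\mathcal H}(\Omega)}$, modulo $u\sim v$ iff $\|u-v\|=0$. $N^{1,\mathcal H}_*(\Omega)=\{u\in N^{1,\mathcal H}(\Omega):\int_\Omega u\,d\mu=0\}$. Local comparability. $\mathcal H$ satisfies the local comparability condition on $E$ if there exist $C\ge1$ and $R_0>0$ such that for every ball $B\subset X$ of radius less than $R_0$, all $x,y\in B\cap E$ and all $\xi\in[0,\infty)$, $\mathcal H(x,\xi)\le C\,\mathcal H(y,C\xi)$. Weak $(1,1)$-Poincaré inequality. $\Omega$ supports it if there are $C>0$, $\lambda>1$ such that for every $u\in L^1_{\mathrm{loc}}(\Omega)$ (integrable on bounded subsets of $\Omega$) with minimal $\mathcal H$-weak upper gradient $g_u$, $\frac1{\mu(B)}\int_B|u-u_B|\,d\mu\le C r\frac1{\mu(\lambda B\cap\Omega)}\int_{\lambda B\cap\Omega}g_u\,d\mu$ for every ball $B=B(x,r)\subset\Omega$; by convention, this assumption includes the same inequality with $B$ replaced by $B\cap\Omega$ on the left-hand side (averages over $B\cap\Omega$) for every ball $B=B(x,r)$ with $x\in\overline\Omega$. Here $u_A=\frac1{\mu(A)}\int_A u\,d\mu$ and $\lambda B=B(x,\lambda r)$. Trace and energy. Under boundedness of $\Omega$, local comparability on $\overline\Omega$ and the weak $(1,1)$-Poincaré inequality,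 there is a bounded linear trace operator $T:N^{1,\mathcal H}(\Omega)\to L^{\mathcal H}(\partial\Omega)$ characterized by $\lim_{r\to0}\frac1{\mu(B(z,r)\cap\Omega)}\int_{B(z,r)\cap\Omega}|u-Tu(z)|\,d\mu=0$ for $\mathscr H$-a.e. $z\in\partial\Omega$. With $\mathcal A(x,\xi)=\frac{\xi^{p(x)}}{p(x)}+a(x)\frac{\xi^{q(x)}}{q(x)}$, set $$\mathcal J_f(u)=\int_\Omega\mathcal A(x,g_u)\,d\mu+\int_{\partial\Omega}f\,Tu\,d\mathscr H,\quad u\in N^{1,\mathcal H}(\Omega).$$ *)

(* Defs.v *)
From HB Require Import structures.
From mathcomp Require Import all_boot all_order all_algebra.
From mathcomp Require Import all_classical all_reals all_analysis.
From mathcomp Require Import measurable_realfun ess_sup_inf.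

Set Implicit Arguments.
Unset Strict Implicit.
Unset Printing Implicit Defensive.

Import Order.TTheory GRing.Theory Num.Theory.
Import numFieldNormedType.Exports.

Local Open Scope classical_set_scope.
Local Open Scope ring_scope.
Local Open Scope ereal_scope.

(* Points are required by the library's complete and measurable types; every
   space containing a domain is nonempty. *)
#[short(type="completeMetricType")]
HB.structure Definition CompleteMetric (R : numDomainType) :=
  {T of Complete T & Metric R T}.

(* Measures on X are outer measures.  Measurability and integration refer to
   the sigma-algebra of Caratheodory measurable sets, so that "measurable" means
   measurable for the measure and not merely Borel. *)
Definition cara_measure (R : realType) (X : pointedType)
    (mu : {outer_measure set X -> \bar R}) :
    {measure set (caratheodory_type mu) -> \bar R} := mu.

Section functions_spaces.
Context {R : realType} {X : pointedType}.
Implicit Types (mu : {outer_measure set X -> \bar R}) (D : set X)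
  (u f g : X -> \bar R) (Phi : X -> \bar R -> \bar R).

Definition mmeasurable_fun mu D u :=
  measurable_fun (D : set (caratheodory_type mu))
    (u : caratheodory_type mu -> \bar R).

Definition mintegral mu D u : \bar R := \int[cara_measure mu]_(x in D) u x.

Definition ae_on mu D (P : X -> Prop) :=
  \forall x \ae cara_measure mu, D x -> P x.

Definition ess_sup_on mu D (w : X -> R) : \bar R :=
  ess_sup (cara_measure mu) (patch (cst -oo) D (EFin \o w)).

Definition ess_inf_on mu D (w : X -> R) : \bar R :=
  ess_inf (cara_measure mu) (patch (cst +oo) D (EFin \o w)).

Definition average mu D u : \bar R :=
  ((fine (mu D))^-1)%:E * mintegral mu D u.

(* Generalized integrands Phi(x, xi) take xi in [0, +oo]. *)
Definition modular mu D Phi u : \bar R :=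
  mintegral mu D (fun x => Phi x `|u x|).

Definition in_LPhi mu D Phi u :=
  mmeasurable_fun mu D u /\ modular mu D Phi u < +oo.

Definition luxemburg_norm mu D Phi u : \bar R :=
  ereal_inf [set t%:E | t in [set t : R | (0 < t)%R /\
    modular mu D Phi (fun x => (t^-1)%:E * u x) <= 1]].

Definition complementary Phi (x : X) (xi : \bar R) : \bar R :=
  ereal_sup [set s%:E * xi - Phi x s%:E | s in [set s : R | (0 <= s)%R]].

Definition double_phase (p q a : X -> R) (x : X) (xi : \bar R) : \bar R :=
  xi `^ (p x) + (a x)%:E * xi `^ (q x).

Definition double_phase_energy (p q a : X -> R) (x : X) (xi : \bar R) : \bar R :=
  ((p x)^-1)%:E * xi `^ (p x) + (a x / q x)%:E * xi `^ (q x).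

(* The inequalities p^- <= p^+ and q^- <= q^+ are automatic when the measure of D
   is nonzero; when it is zero, ess inf = +oo and ess sup = -oo, and the
   conditions below hold trivially. *)
Definition double_phase_data mu D (p q a : X -> R) :=
  [/\ [/\ mmeasurable_fun mu D (EFin \o p), mmeasurable_fun mu D (EFin \o q) &
          mmeasurable_fun mu D (EFin \o a)],
      forall x, D x -> [/\ (1 < p x)%R, (p x < q x)%R & (0 <= a x)%R],
      1 < ess_inf_on mu D p /\ ess_sup_on mu D p < +oo,
      1 < ess_inf_on mu D q /\ ess_sup_on mu D q < +oo &
      ess_sup_on mu D a < +oo].

End functions_spaces.

Section metric.
Context {R : realType} {X : completeMetricType R}.
Implicit Types (mu nu : {outer_measure set X -> \bar R}) (Om : set X).

Definition metric_bounded (A : set X) := exists (x : X) (r : R), A `<=` ball x r.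

Definition domain Om := [/\ open Om, connected Om & Om !=set0].

Definition frontier Om : set X := closure Om `\` interior Om.

Definition borel_sets : set (set X) := <<s @open X >>.

Definition borel_fun (D : set X) (h : X -> \bar R) :=
  measurable_fun (D : set (g_sigma_algebraType (@open X)))
    (h : g_sigma_algebraType (@open X) -> \bar R).

Definition borel_regular mu :=
  borel_sets `<=` mu.-caratheodory /\
  forall A : set X, exists B, [/\ borel_sets B, A `<=` B & mu B = mu A].

Definition sigma_finite_outer mu := sigma_finite setT (cara_measure mu).

Definition restricted_doubling mu Om := exists C : R, (1 <= C)%R /\
  forall x (r : R), closure Om x -> (0 < r)%R ->
    mu (ball x (2 * r) `&` Om) <= C%:E * mu (ball x r `&` Om).

Definition upper_codimension mu nu Om (theta : R) := exists C : R, (0 < C)%R /\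
  forall x (r : R), frontier Om x -> (0 < r)%R ->
    nu (ball x r `&` frontier Om) <=
      (C * powR r (- theta))%:E * mu (ball x r `&` Om).

Definition local_comparability (E : set X) (Phi : X -> \bar R -> \bar R) :=
  exists C R0 : R, [/\ (1 <= C)%R, (0 < R0)%R &
    forall z (r : R), (0 < r < R0)%R ->
    forall x y, (ball z r `&` E) x -> (ball z r `&` E) y ->
    forall xi : R, (0 <= xi)%R -> Phi x xi%:E <= C%:E * Phi y (C * xi)%:E].

(* Only the restriction of cpath to [0, clen] matters. *)
Record curve := Curve { clen : R ; cpath : R -> X }.

Definition curve_length (c : R -> X) (s t : R) : \bar R :=
  ereal_sup [set (\sum_(0 <= i < size l)
      mdist (c (nth t (s :: l) i)) (c (nth t (s :: l) i.+1)))%:E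
    | l in [set l : seq R | itv_partition s t l]].

(* Parametrization is by arc length; 0 < clen says that the curve is
   nonconstant. *)
Definition rectifiable_curve_in (D : set X) (c : curve) :=
  [/\ (0 < clen c)%R,
      {within `[0%R, clen c], continuous (cpath c)},
      forall t : R, (0 <= t <= clen c)%R ->
        curve_length (cpath c) 0 t = t%:E &
      forall t : R, (0 <= t <= clen c)%R -> D (cpath c t)].

Definition line_integral (c : curve) (h : X -> \bar R) : \bar R :=
  \int[lebesgue_measure]_(t in `[0%R, clen c]) h (cpath c t).

Section newtonian.
Variables (mu : {outer_measure set X -> \bar R}) (Om : set X)
  (Phi : X -> \bar R -> \bar R).
Implicit Types (u g : X -> \bar R).

Definition admissible (Gam : set curve) (h : X -> \bar R) :=
  [/\ borel_fun Om h, forall x, Om x -> 0 <= h x &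
      forall c, Gam c -> 1 <= line_integral c h].

Definition modulus (Gam : set curve) : \bar R :=
  ereal_inf [set mintegral mu Om (fun x => Phi x (h x)) | h in admissible Gam].

(* In \bar R the difference of two equal infinities is -oo, so that its absolute
   value is +oo, as the convention for upper gradients requires. *)
Definition weak_upper_gradient u g :=
  [/\ borel_fun Om g, forall x, Om x -> 0 <= g x &
    exists Gam : set curve,
      [/\ Gam `<=` rectifiable_curve_in Om, modulus Gam = 0 &
        forall c, rectifiable_curve_in Om c -> ~ Gam c ->
          `|u (cpath c 0%R) - u (cpath c (clen c))| <= line_integral c g]].

Definition minimal_weak_upper_gradient u g :=
  [/\ weak_upper_gradient u g, in_LPhi mu Om Phi g &
    forall g', weak_upper_gradient u g' -> in_LPhi mu Om Phi g' ->
      ae_on mu Om (fun x => g x <= g' x)].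

(* Unique up to a null set whenever u has a weak upper gradient in L^Phi. *)
Definition min_gradient u : X -> \bar R :=
  xget (cst 0) [set g | minimal_weak_upper_gradient u g].

(* Membership is stated for representatives: everywhere defined functions. *)
Definition newtonian u :=
  in_LPhi mu Om Phi u /\
  exists g, weak_upper_gradient u g /\ in_LPhi mu Om Phi g.

Definition newtonian_norm u : \bar R :=
  luxemburg_norm mu Om Phi u + luxemburg_norm mu Om Phi (min_gradient u).

Definition newtonian_mean0 u := newtonian u /\ mintegral mu Om u = 0.

Definition bounded_integrable u :=
  forall A : set X, mu.-caratheodory A -> A `<=` Om -> metric_bounded A ->
    (cara_measure mu).-integrable A u.

(* Oscillation is over B `&` Om for all balls B centered in the closure of Om;
   the balls B contained in Om are the case B `&` Om = B. *)
Definition weak_poincare := exists C lam : R, [/\ (0 < C)%R, (1 < lam)%R &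
  forall u g, mmeasurable_fun mu Om u -> bounded_integrable u ->
    minimal_weak_upper_gradient u g ->
    forall x (r : R), closure Om x -> (0 < r)%R ->
      average mu (ball x r `&` Om)
        (fun y => `|u y - average mu (ball x r `&` Om) u|) <=
      (C * r)%:E * average mu (ball x (lam * r) `&` Om) g].

Definition trace_operator nu (T : (X -> \bar R) -> X -> \bar R) :=
  [/\ forall u, newtonian u -> in_LPhi nu (frontier Om) Phi (T u),
      forall (c : R) u v, newtonian u -> newtonian v ->
        ae_on nu (frontier Om) (fun z =>
          T (fun x => c%:E * u x + v x) z = c%:E * T u z + T v z),
      exists C : R, (0 <= C)%R /\ forall u, newtonian u ->
        luxemburg_norm nu (frontier Om) Phi (T u) <= C%:E * newtonian_norm u &
      forall u, newtonian u -> ae_on nu (frontier Om) (fun z =>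
        average mu (ball z r `&` Om) (fun x => `|u x - T u z|)
          @[r --> (0%R : R)^'+] --> 0)].

Definition energy_functional nu (A : X -> \bar R -> \bar R)
    (T : (X -> \bar R) -> X -> \bar R) (f u : X -> \bar R) : \bar R :=
  mintegral mu Om (fun x => A x (min_gradient u x)) +
  mintegral nu (frontier Om) (fun z => f z * T u z).

(* The set of u in N^{1,Phi}_* at which J attains its infimum over
   N^{1,Phi}_*. *)
Definition minimizers (J : (X -> \bar R) -> \bar R) : set (X -> \bar R) :=
  [set u | newtonian_mean0 u /\ J u = ereal_inf (J @` newtonian_mean0)].

End newtonian.
End metric.

(* Main.v *)
(* Let w = (u + v) / 2. The function (g_u + g_v) / 2 is a weak upper gradient
   of w, the boundary term is affine along the segment (and finite, by Young's
   inequality), and u, v are minimizers; hence the energy of (g_u + g_v) / 2 is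
   at least the mean of the energies of g_u and g_v. Since A(x, .) is strictly
   convex, this forces g_u = g_v almost everywhere. *)

Require Import Defs.
From HB Require Import structures.
From mathcomp Require Import all_boot all_order all_algebra.
From mathcomp Require Import all_classical all_reals all_analysis.
From mathcomp Require Import measurable_realfun ess_sup_inf.
From mathcomp Require Import ring lra.

Set Implicit Arguments.
Unset Strict Implicit.
Unset Printing Implicit Defensive.

Import Order.TTheory GRing.Theory Num.Theory.
Import numFieldNormedType.Exports.

Local Open Scope classical_set_scope.
Local Open Scope ring_scope.
Local Open Scope ereal_scope.

(** The main obstacle is arithmetic in the extended reals: functions, gradients and traces may be
    infinite, and there sums need not cancel nor products distribute. Finiteness is therefore
    secured before anything is subtracted. The energies of the minimal gradients of [u] and [v] are
    finite because [double_phase_energy] is dominated by [double_phase]; together with finite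
    boundary terms this makes the common infimum a real number, from which the boundary part can be
    removed. Linearity is used in the form [w + w = u + v], which survives infinite values. The
    value of the functional at [w] sees only [min_gradient] of [w]. It lies almost everywhere below
    the mean of the two gradients, and monotonicity of the energy density carries the lower bound
    over to that mean. Strict convexity has to come from the [p]-term alone, since the weight [a]
    may vanish, and it says nothing where the density is infinite; hence equality of the integrals
    is turned into almost everywhere equality with finite common value. *)

Section powR_convexity.
Context {R : realType}.
Local Open Scope ring_scope.

(** Strict convexity of [expR] between [t] and 0. The strict bounds [1 + x < expR x] at
    [(1 - th) * t] and at [- (th * t)], weighted by [th] and [1 - th], have linear terms that
    cancel; multiplication by [expR (th * t)] gives the claim. *)
Lemma expR_weighted_lt (th t : R) : 0 < th < 1 -> t != 0 ->
  expR (th * t) < th * expR t + (1 - th).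
Proof.
move=> /andP[th0 th1] t0.
have h1 : 1 + (1 - th) * t < expR ((1 - th) * t).
  by apply: expR_gt1Dx; rewrite mulf_neq0// subr_eq0 gt_eqF.
have h2 : 1 + - (th * t) < expR (- (th * t)).
  by apply: expR_gt1Dx; rewrite oppr_eq0 mulf_neq0// gt_eqF.
have e1 : expR t = expR ((1 - th) * t) * expR (th * t).
  by rewrite -expRD; congr expR; ring.
have e2 : expR (- (th * t)) * expR (th * t) = 1.
  by rewrite -expRD addNr expR0.
have e0 := expR_gt0 (th * t).
set A := expR (th * t) in e0 e1 e2 *; rewrite e1.
set B := expR ((1 - th) * t) in h1 *; set C := expR (- (th * t)) in h2 e2.
have pos : 0 < (th * B + (1 - th) * C - 1) * A.
  apply: mulr_gt0 => //.
  have -> : th * B + (1 - th) * C - 1 =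
      th * (B - (1 + (1 - th) * t)) + (1 - th) * (C - (1 + - (th * t))) by ring.
  by rewrite addr_gt0// mulr_gt0// subr_gt0.
rewrite -subr_gt0; suff <- : (th * B + (1 - th) * C - 1) * A =
  th * (B * A) + (1 - th) - A by [].
by rewrite mulrBl mul1r mulrDl -!mulrA e2 mulr1.
Qed.

(** Strict Bernoulli inequality: the weighted exponential bound with [th = s^-1] and [t = s * ln x],
    multiplied by [s]. The point 0, where the logarithm is no use, is treated apart. *)
Lemma powR_gt_tangent (s x : R) : 1 < s -> 0 <= x -> x != 1 ->
  1 + s * (x - 1) < x `^ s.
Proof.
move=> s1 x0 x1; have s0 : 0 < s by lra.
have [->|xn0] := eqVneq x 0; first by rewrite powR0 ?gt_eqF//; lra.
have xp : 0 < x by rewrite lt0r xn0.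
have s1V : 0 < s^-1 < 1 by rewrite invr_gt0 s0 invf_lt1.
have t0 : s * ln x != 0 by rewrite mulf_eq0 (gt_eqF s0) ln_eq0.
have := expR_weighted_lt s1V t0; rewrite mulrA mulVf ?gt_eqF// mul1r.
rewrite lnK ?posrE//.
have -> : expR (s * ln x) = x `^ s by rewrite /powR (negbTE xn0).
rewrite -(ltr_pM2l s0) mulrDr mulrA divff ?gt_eqF// mul1r mulrBr divff ?gt_eqF//.
lra.
Qed.

(** By homogeneity both points may be divided by their midpoint [m]. Then [x / m + y / m = 2], and
    adding the two Bernoulli inequalities at these quotients cancels the linear terms. *)
Lemma powR_midpoint_lt (s x y : R) : 1 < s -> 0 <= x -> 0 <= y -> x != y ->
  (2^-1 * (x + y)) `^ s < 2^-1 * (x `^ s + y `^ s).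
Proof.
move=> s1 x0 y0 xy; set m := 2^-1 * (x + y).
have m0 : 0 < m.
  rewrite /m; apply: mulr_gt0; first by rewrite invr_gt0.
  by rewrite lt0r addr_ge0// andbT paddr_eq0//; apply: contra xy => /andP[/eqP-> /eqP->].
have neq1 z : z != m -> z / m != 1.
  by apply: contra => /eqP h; rewrite -(divfK (lt0r_neq0 m0) z) h mul1r.
have hx : 1 + s * (x / m - 1) < (x / m) `^ s.
  apply: powR_gt_tangent => //; first by rewrite divr_ge0// ltW.
  by apply: neq1; apply: contra xy => /eqP h; apply/eqP; move: h; rewrite /m; lra.
have hy : 1 + s * (y / m - 1) < (y / m) `^ s.
  apply: powR_gt_tangent => //; first by rewrite divr_ge0// ltW.
  by apply: neq1; apply: contra xy => /eqP h; apply/eqP; move: h; rewrite /m; lra.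
have scale z : 0 <= z -> z `^ s = (z / m) `^ s * m `^ s.
  by move=> z0; rewrite -powRM ?divr_ge0 ?(ltW m0)// divfK ?lt0r_neq0.
rewrite (scale x)// (scale y)//.
have ms : 0 < m `^ s by rewrite powR_gt0.
have e : x / m + y / m = 2 by rewrite -mulrDl /m; field; lra.
have sum_gt2 : 2 < (x / m) `^ s + (y / m) `^ s.
  have := ltrD hx hy; rewrite addrACA -mulrDr addrACA e.
  by rewrite -opprD subrr mulr0 addr0.
rewrite -mulrDl mulrA -[ltLHS]mul1r ltr_pM2r//; lra.
Qed.

Lemma powR_midpoint_le (s x y : R) : 1 < s -> 0 <= x -> 0 <= y ->
  (2^-1 * (x + y)) `^ s <= 2^-1 * (x `^ s + y `^ s).
Proof.
move=> s1 x0 y0; have [->|xy] := eqVneq x y; last exact/ltW/powR_midpoint_lt.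
have half (z : R) : 2^-1 * (z + z) = z by field.
by rewrite !half.
Qed.

End powR_convexity.

Lemma half_mul_pinfty {R : realType} (x y : \bar R) : x = +oo -> 0 <= y ->
  (2^-1)%:E * (x + y) = +oo.
Proof.
move=> -> y0; rewrite addye ?gt0_muley ?lte_fin ?invr_gt0//.
by rewrite gt_eqF// (lt_le_trans ltNy0).
Qed.

(** * Convexity of sums of two powers on [[0, +oo]] *)

Section two_power.
Context {R : realType}.
Implicit Types (b c r s : R) (x y : \bar R).

(** Common shape of [double_phase] (coefficients 1 and [a]) and [double_phase_energy] (coefficients
    [1/p] and [a/q]) at a fixed point, so that monotonicity, convexity and measurability are proved
    once for both. *)
Definition two_power b c r s x : \bar R := b%:E * x `^ r + c%:E * x `^ s.

Lemma two_power_ge0 b c r s x : (0 <= b)%R -> (0 <= c)%R ->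
  0 <= two_power b c r s x.
Proof. by move=> b0 c0; rewrite adde_ge0// mule_ge0// ?lee_fin// poweR_ge0. Qed.

Lemma two_power_EFin b c r s (t : R) :
  two_power b c r s t%:E = (b * t `^ r + c * t `^ s)%:E.
Proof. by []. Qed.

Lemma two_power0 b c r s : (0 < r)%R -> (0 < s)%R -> two_power b c r s 0 = 0.
Proof. by move=> r0 s0; rewrite /two_power !poweR0r ?gt_eqF// !mule0 adde0. Qed.

Lemma two_power_pinfty b c r s : (0 < b)%R -> (0 <= c)%R -> (0 < r)%R ->
  two_power b c r s +oo = +oo.
Proof.
move=> b0 c0 r0; rewrite /two_power eqy_poweR// gt0_muley ?lte_fin//.
by rewrite addye// gt_eqF// (lt_le_trans ltNy0)// mule_ge0// ?lee_fin// poweR_ge0.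
Qed.

Lemma two_power_le b c r s x y : (0 <= b)%R -> (0 <= c)%R -> (0 <= r)%R ->
  (0 <= s)%R -> 0 <= x -> x <= y -> two_power b c r s x <= two_power b c r s y.
Proof.
move=> b0 c0 r0 s0 x0 xy; have y0 := le_trans x0 xy.
have mem (z : \bar R) : 0 <= z -> z \in `[0, +oo].
  by move=> z0; rewrite in_itv/= z0; exact: leey.
by apply: leeD; apply: lee_pmul => //; rewrite ?lee_fin ?poweR_ge0//;
   apply: gt0_ler_poweR; rewrite ?mem.
Qed.

Lemma two_power_midpoint_le b c r s x y : (0 < b)%R -> (0 <= c)%R ->
  (1 < r)%R -> (1 < s)%R -> 0 <= x -> 0 <= y ->
  two_power b c r s ((2^-1)%:E * (x + y)) <=
  (2^-1)%:E * (two_power b c r s x + two_power b c r s y).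
Proof.
move=> b0 c0 r1 s1 x0 y0.
have r0 : (0 < r)%R by lra. have hb := ltW b0.
case: x x0 => [x| |//] x0; last first.
  by rewrite two_power_pinfty// [leRHS]half_mul_pinfty ?leey// two_power_ge0.
case: y y0 => [y| |//] y0; last first.
  rewrite two_power_pinfty// (addeC (two_power _ _ _ _ _)) [leRHS]half_mul_pinfty ?leey//.
  by rewrite two_power_ge0.
rewrite -EFinD -EFinM !two_power_EFin -EFinD -EFinM lee_fin.
rewrite !lee_fin in x0 y0.
have := powR_midpoint_le r1 x0 y0; have := powR_midpoint_le s1 x0 y0.
set A := (_ `^ s)%R; set B := (_ `^ r)%R; set C := (_ * (_ + _))%R.
move=> hA; set D := (_ * (_ + _))%R => hB.
have := lerD (ler_wpM2l hb hB) (ler_wpM2l c0 hA).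
move=> /le_trans; apply; rewrite le_eqVlt; apply/orP; left; apply/eqP.
by rewrite /C /D; ring.
Qed.

(** Strictness comes from the [r]-term, as [b] is positive while [c] may be 0. Finiteness excludes
    [+oo] for [x] and [y]: there both sides are [+oo] and their equality carries no information. *)
Lemma two_power_midpoint_inj b c r s x y : (0 < b)%R -> (0 <= c)%R ->
  (1 < r)%R -> (1 < s)%R -> 0 <= x -> 0 <= y ->
  two_power b c r s ((2^-1)%:E * (x + y)) =
    (2^-1)%:E * (two_power b c r s x + two_power b c r s y) ->
  (2^-1)%:E * (two_power b c r s x + two_power b c r s y) \is a fin_num ->
  x = y.
Proof.
move=> b0 c0 r1 s1 x0 y0 + fin.
have r0 : (0 < r)%R by lra. have hb := ltW b0.
case: x x0 fin => [x| |//] x0; last first.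
  by rewrite two_power_pinfty// (@half_mul_pinfty _ +oo (two_power _ _ _ _ _))//
    two_power_ge0.
case: y y0 => [y| |//] y0; last first.
  rewrite two_power_pinfty// (addeC (two_power _ _ _ _ _)).
  by rewrite (@half_mul_pinfty _ +oo (two_power _ _ _ _ _))// two_power_ge0.
move=> _; rewrite -EFinD -EFinM !two_power_EFin -EFinD -EFinM => -[].
rewrite !lee_fin in x0 y0.
have [->//|xy] := eqVneq x y.
have := powR_midpoint_lt r1 x0 y0 xy; have := powR_midpoint_le s1 x0 y0.
set A := (_ `^ s)%R; set B := (_ `^ r)%R; set C := (_ * (_ + _))%R.
move=> hA; set D := (_ * (_ + _))%R => hB.
rewrite -(ltr_pM2l b0) in hB.
have := ltr_leD hB (ler_wpM2l c0 hA).
move=> /[swap] ->; rewrite (_ : (b * D + c * C)%R =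
    (2^-1 * (b * x `^ r + c * x `^ s + (b * y `^ r + c * y `^ s)))%R).
  by rewrite ltxx.
by rewrite /C /D; ring.
Qed.

End two_power.

Section ereal_facts.
Context {R : realType}.
Implicit Types x y : \bar R.

(** Being valid at infinite values too, it makes [w + w] and [u + v] the same function for the
    midpoint [w], so that [T] is applied to one and the same argument. *)
Lemma half_add (x : \bar R) : (2^-1)%:E * x + (2^-1)%:E * x = x.
Proof.
case: x => [t| |]; last 2 first.
- by rewrite gt0_muley ?lte_fin ?invr_gt0.
- by rewrite gt0_muleNy ?lte_fin ?invr_gt0.
by rewrite -!EFinM -EFinD; congr EFin; field.
Qed.

Lemma le_1DpoweR (r : R) (t : \bar R) : (1 <= r)%R -> 0 <= t -> t <= 1 + t `^ r.
Proof.
move=> r1; case: t => [t| |]//; last by rewrite eqy_poweR//; lra.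
rewrite !lee_fin => t0; have [t1|/ltW t1] := leP t 1%R.
  by rewrite (le_trans t1)// lerDl powR_ge0.
by rewrite (le_trans (le1r_powR t1 r1))// lerDr.
Qed.

(** Replaces distributivity. If [f] is infinite, a finite product forces the other factor to be 0;
    if [f] is 0, both sides vanish; otherwise all factors are finite. *)
Lemma mule_double_eq (f x y w : \bar R) : f * x \is a fin_num ->
  f * y \is a fin_num -> f * w \is a fin_num -> w + w = x + y ->
  f * w + f * w = f * x + f * y.
Proof.
have eq0 (c z : \bar R) : c \isn't a fin_num -> c * z \is a fin_num -> z = 0.
  case: c => // _; have [zn|zp|//] := ltgtP z 0.
  - by rewrite lt0_mulye.
  - by rewrite gt0_mulye.
  - by rewrite lt0_mulNye.
  - by rewrite gt0_mulNye.
have [ffin|finf] := boolP (f \is a fin_num); last first.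
  by move=> /(eq0 _ _ finf)-> /(eq0 _ _ finf)-> /(eq0 _ _ finf)->; rewrite !mule0.
have [->|f0] := eqVneq f 0; first by rewrite !mul0e.
have fin z : f * z \is a fin_num -> z \is a fin_num.
  move=> fz; apply: contraTT fz => zinf; apply/negP; rewrite muleC.
  by move=> /(eq0 _ _ zinf)/eqP; apply/negP.
move=> /fin xf /fin yf /fin wf wxy.
by rewrite -!muleDr ?wxy// ?fin_num_adde_defl.
Qed.

(** [E] stands for energies and [L] for boundary terms. Averaging the two equations for [I] and
    using [LW = (LU + LV) / 2] lets the finite boundary terms cancel; an infinite [EW] is
    harmless. *)
Lemma convex_comparison (EU EV EW LU LV LW I : \bar R) :
  0 <= EU -> 0 <= EV -> 0 <= EW -> EU < +oo -> EV < +oo ->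
  LU \is a fin_num -> LV \is a fin_num -> LW \is a fin_num ->
  LW + LW = LU + LV -> EU + LU = I -> EV + LV = I -> I <= EW + LW ->
  (2^-1)%:E * (EU + EV) <= EW.
Proof.
case: EW => [EW| |]//; last by move=> *; exact: leey.
case: EU => [EU| |]// _; case: EV => [EV| |]// _ _ _ _.
case: LU => [LU| |]// _; case: LV => [LV| |]// _; case: LW => [LW| |]// _.
rewrite -!EFinD => -[e] <- -[e'].
by rewrite -EFinM !lee_fin; lra.
Qed.

End ereal_facts.

Section midpoint.
Context {R : realType} {X : Type}.
Implicit Types (u v : X -> \bar R) (x y : X).

Definition midpoint u v x : \bar R := (2^-1)%:E * (u x + v x).

Lemma abse_midpoint_le u v x :
  `|midpoint u v x| <= midpoint (abse \o u) (abse \o v) x.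
Proof.
rewrite /midpoint abseM gee0_abs; last by rewrite lee_fin invr_ge0.
by rewrite lee_pmul2l// ?lte_fin ?invr_gt0// lee_abs_add.
Qed.

(* The convention that equal infinities are at distance [+oo] makes this hold
   without any finiteness assumption. *)
Lemma abse_midpoint_sub_le u v x y :
  `|midpoint u v x - midpoint u v y| <=
  (2^-1)%:E * (`|u x - u y| + `|v x - v y|).
Proof.
rewrite /midpoint.
have [uy|] := eqVneq `|u x - u y| +oo; first by rewrite (half_mul_pinfty uy)// leey.
have [vy|] := eqVneq `|v x - v y| +oo.
  by rewrite (addeC `|u x - u y|) (half_mul_pinfty vy)// leey.
case: (v x) (v y) (u x) (u y) => [b| |] [b'| |]// [c| |] [c'| |]// _ _.
change ((`|2^-1 * (c + b) - 2^-1 * (c' + b')|)%:E <=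
  (2^-1 * (`|c - c'| + `|b - b'|))%:E).
rewrite lee_fin.
have -> : (2^-1 * (c + b) - 2^-1 * (c' + b') = 2^-1 * ((c - c') + (b - b')))%R.
  by ring.
by rewrite normrM ger0_norm// ler_pM2l// ler_normD.
Qed.

End midpoint.

Section measurable_two_power.
Context {R : realType}.

Lemma measurable_expeR : measurable_fun [set: \bar R] (@expeR R).
Proof.
rewrite (_ : expeR = fun x => if x == +oo then +oo else
    if x == -oo then 0 else (expR (fine x))%:E); last first.
  by apply/funext => -[].
apply: measurable_fun_ifT => //=; first exact: measurable_fun_eqe.
apply: measurable_fun_ifT => //=; first exact: measurable_fun_eqe.
apply/measurable_EFinP => /=.
exact: (@measurableT_comp _ _ _ _ _ _ (@expR R)).
Qed.

Lemma measurable_lne : measurable_fun [set: \bar R] (@lne R).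
Proof.
rewrite (_ : @lne R = fun x => if x == +oo then +oo else
    if x <= 0 then -oo else (ln (fine x))%:E); last first.
  by apply/funext => -[x| |]//=; rewrite ?lee_fin ?leNye.
apply: measurable_fun_ifT => //=; first exact: measurable_fun_eqe.
apply: measurable_fun_ifT => //=; first exact: measurable_fun_lee.
apply/measurable_EFinP => /=.
exact: (@measurableT_comp _ _ _ _ _ _ (@ln R)).
Qed.

(** Since the exponents vary with the point, measurability of a power is reduced to that of a
    product inside an exponential. Positivity of [r] matters at 0, where the logarithm is [-oo] and
    [r * -oo] must stay [-oo]. *)
Lemma poweR_expeR (x : \bar R) (r : R) : 0 <= x -> (0 < r)%R ->
  x `^ r = @expeR R (r%:E * @lne R x).
Proof.
move=> x0 r0; case: x x0 => [x| |//]; last first.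
  by rewrite eqy_poweR// gt0_muley ?lte_fin.
rewrite lee_fin /= /powR le_eqVlt => /predU1P[<-|x0].
  by rewrite eqxx lexx gt_eqF// gt0_muleNy ?lte_fin.
by rewrite gt_eqF// leNgt x0.
Qed.

Context d (T : measurableType d).
Implicit Types (D : set T) (r s : T -> R) (u : T -> \bar R).

Lemma measurable_poweR_exponent D u r : (forall x, D x -> 0 <= u x) ->
  (forall x, D x -> (0 < r x)%R) -> measurable_fun D u ->
  measurable_fun D (EFin \o r) -> measurable_fun D (fun x => u x `^ r x).
Proof.
move=> u0 r0 mu mr.
apply: (@eq_measurable_fun _ _ _ _ _ (fun x => @expeR R ((r x)%:E * @lne R (u x)))).
  by move=> x /set_mem Dx; rewrite poweR_expeR ?u0 ?r0.
apply: (measurableT_comp measurable_expeR); apply: emeasurable_funM => //.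
exact: (measurableT_comp measurable_lne).
Qed.

Lemma measurable_two_power D u (b c r s : T -> R) :
  (forall x, D x -> 0 <= u x) ->
  (forall x, D x -> (0 < r x)%R) -> (forall x, D x -> (0 < s x)%R) ->
  measurable_fun D u -> measurable_fun D (EFin \o b) ->
  measurable_fun D (EFin \o c) ->  measurable_fun D (EFin \o r) ->
  measurable_fun D (EFin \o s) ->
  measurable_fun D (fun x => two_power (b x) (c x) (r x) (s x) (u x)).
Proof.
by move=> *; apply: emeasurable_funD; apply: emeasurable_funM => //;
   apply: measurable_poweR_exponent.
Qed.

End measurable_two_power.

(** * Comparison of integrals *)

Section integral_facts.
Context d (T : measurableType d) {R : realType} (mu : {measure set T -> \bar R}).
Implicit Types (D : set T) (f g : T -> \bar R).

(* Unlike [ge0_le_integral], no measurability: the integral is a supremum over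
   simple functions below. *)
Lemma ge0_le_lower_integral D f g : (forall x, D x -> 0 <= f x) ->
  (forall x, D x -> f x <= g x) ->
  \int[mu]_(x in D) f x <= \int[mu]_(x in D) g x.
Proof.
move=> f0 fg; have g0 x : D x -> 0 <= g x by move=> Dx; rewrite (le_trans (f0 x Dx)) ?fg.
rewrite !ge0_integralE//; apply: ub_ereal_sup => _ [h /= hf <-]; apply: ereal_sup_ubound.
exists h => //= x; apply: (le_trans (hf x)).
by rewrite !patchE; case: ifPn => // /set_mem; exact: fg.
Qed.

(** The difference [g - f] is nonnegative with integral 0. Both functions are integrable, hence
    almost everywhere finite, which gives the subtraction a meaning; finiteness of [g] is kept in
    the conclusion for the strict convexity argument. *)
Lemma integral_squeeze_ae_eq D f g : measurable D ->
  measurable_fun D f -> measurable_fun D g ->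
  (forall x, D x -> 0 <= f x) -> (forall x, D x -> f x <= g x) ->
  \int[mu]_(x in D) g x < +oo ->
  \int[mu]_(x in D) g x <= \int[mu]_(x in D) f x ->
  {ae mu, forall x, D x -> f x = g x /\ g x \is a fin_num}.
Proof.
move=> mD mf mg f0 fg gfin gf.
have g0 x : D x -> 0 <= g x by move=> Dx; rewrite (le_trans (f0 x Dx)) ?fg.
have int_lty h : measurable_fun D h -> (forall x, D x -> 0 <= h x) ->
    \int[mu]_(x in D) h x < +oo -> mu.-integrable D h.
  move=> mh h0 hfin; apply/integrableP; split => //.
  by under eq_integral => x /set_mem Dx do rewrite gee0_abs ?h0//.
have ig := int_lty g mg g0 gfin.
have If : mu.-integrable D f.
  apply: int_lty => //; apply: le_lt_trans gfin; exact: ge0_le_integral.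
have fing := integrable_ae mD ig; have finf := integrable_ae mD If.
have mgf : measurable_fun D (g \- f) by exact: emeasurable_funB.
have : \int[mu]_(x in D) `|(g \- f) x| = 0.
  transitivity (\int[mu]_(x in D) (g \- f) x).
    apply: ae_eq_integral => //; first exact: measurableT_comp.
    apply: filterS2 finf fing => x /= h1 h2 Dx; rewrite gee0_abs//.
    by rewrite sube_ge0 ?fg ?h1 ?h2// orbT.
  transitivity (\int[mu]_(x in D) g x - \int[mu]_(x in D) f x).
    exact: integralB.
  have := integrable_fin_num mD ig; have := integrable_fin_num mD If.
  have : \int[mu]_(x in D) f x <= \int[mu]_(x in D) g x by exact: ge0_le_integral.
  move: gf; case: (integral _ _ f) => [s| |]//; case: (integral _ _ g) => [t| |]//.
  rewrite !lee_fin => ts st _ _.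
  by rewrite -EFinB (le_anti (introT andP (conj ts st))) subrr.
move/(ae_eq_integral_abs mu mD mgf) => gf0.
apply: filterS3 gf0 finf fing => x /= h1 h2 h3 Dx; split; last exact: h3.
have := h1 Dx; have := h2 Dx; have := h3 Dx; case: (f x) (g x) => [s| |] [t| |]//= _ _.
by move=> [/eqP]; rewrite subr_eq0 => /eqP ->.
Qed.

End integral_facts.

(** * Borel functions and integrals along curves *)

Section borel.
Context {R : realType} {X : completeMetricType R}.
Implicit Types (mu : {outer_measure set X -> \bar R}) (Om : set X)
  (h g : X -> \bar R).

Lemma open_caratheodory mu Om : borel_regular mu -> open Om ->
  mu.-caratheodory Om.
Proof. by move=> [bm _] oOm; apply: bm; exact: sub_sigma_algebra. Qed.

Lemma frontier_caratheodory mu Om : borel_regular mu ->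
  mu.-caratheodory (frontier Om).
Proof.
move=> rmu.
apply: (@measurableD _ (caratheodory_type mu)); last first.
  by apply: open_caratheodory => //; exact: open_interior.
rewrite -(setCK (closure Om)); apply: (@measurableC _ (caratheodory_type mu)).
by apply: open_caratheodory => //; apply: closed_openC; exact: closed_closure.
Qed.

Lemma borel_mmeasurable mu Om h : borel_regular mu -> open Om ->
  borel_fun Om h -> mmeasurable_fun mu Om h.
Proof.
move=> [bm _] oOm bh mOm Y mY; apply: bm; apply: bh => //.
exact: sub_sigma_algebra.
Qed.

(** Preimages of open sets under the continuous path are relatively open, and open sets generate the
    Borel sets. Borel measurability of [h] is what makes this work: a function measurable only for
    [mu] need not remain measurable along a curve. *)
Lemma measurable_along_curve Om c h : open Om -> rectifiable_curve_in Om c ->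
  borel_fun Om h ->
  measurable_fun (`[0%R, clen c]%classic : set R) (h \o cpath c).
Proof.
move=> oOm [_ cc _ cOm] bh.
apply: (@measurable_comp _ _ _ _ (g_sigma_algebraType (@open X)) _ Om) => //.
- exact: sub_sigma_algebra.
- by move=> _ [t It <-]; apply: cOm; move: It; rewrite /= in_itv.
apply: (@measurability _ _ _ (g_sigma_algebraType (@open X)) _ _ (@open X)) => //.
move=> _ [G oG <-]; apply: open_measurable_subspace => //.
by move/continuousP : cc; apply.
Qed.

Lemma line_integral_midpoint Om c g h : open Om -> rectifiable_curve_in Om c ->
  borel_fun Om g -> borel_fun Om h ->
  (forall x, Om x -> 0 <= g x) -> (forall x, Om x -> 0 <= h x) ->
  line_integral c (fun x => (2^-1)%:E * (g x + h x)) =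
  (2^-1)%:E * (line_integral c g + line_integral c h).
Proof.
move=> oOm rc bg bh g0 h0; have [_ _ _ cOm] := rc.
have mc f : borel_fun Om f ->
    measurable_fun (`[0%R, clen c]%classic : set R) (f \o cpath c).
  exact: measurable_along_curve.
have c0 (f : X -> \bar R) : (forall x, Om x -> 0 <= f x) ->
    forall t, `[0%R, clen c]%classic t -> 0 <= f (cpath c t).
  by move=> f0 t; rewrite /= in_itv/= => /cOm /f0.
rewrite /line_integral ge0_integralZl//.
- by rewrite ge0_integralD//; [exact: c0|exact: mc|exact: c0|exact: mc].
- by apply: emeasurable_funD; exact: mc.
- by move=> t It; apply: adde_ge0; [exact: (c0 g g0)|exact: (c0 h h0)].
Qed.

End borel.

Section ae_on.
Context {R : realType} {X : pointedType}.
Implicit Types (mu : {outer_measure set X -> \bar R}) (D : set X).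

Lemma ae_on_filter mu : Filter (almost_everywhere (cara_measure mu)).
Proof. exact: (@ae_filter_ringOfSetsType _ (caratheodory_type mu)). Qed.

Lemma ae_onS mu D (P Q : X -> Prop) : (forall x, D x -> P x -> Q x) ->
  ae_on mu D P -> ae_on mu D Q.
Proof.
move=> PQ; apply: (@filterS _ _ (ae_on_filter mu)) => x Px Dx.
exact: PQ (Px Dx).
Qed.

Lemma ae_onI mu D (P Q : X -> Prop) :
  ae_on mu D P -> ae_on mu D Q -> ae_on mu D (fun x => P x /\ Q x).
Proof.
by apply: (@filterS2 _ _ (ae_on_filter mu)) => x Px Qx Dx; split; auto.
Qed.

End ae_on.

(** * The double-phase integrand: Young's inequality, modulars and energies *)

Section phase.
Context {R : realType} {X : completeMetricType R}
  (mu : {outer_measure set X -> \bar R}) (D : set X) (p q a : X -> R).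
Context (mD : mu.-caratheodory D)
  (mp : mmeasurable_fun mu D (EFin \o p)) (mq : mmeasurable_fun mu D (EFin \o q))
  (ma : mmeasurable_fun mu D (EFin \o a))
  (pqa : forall x, D x -> [/\ (1 < p x)%R, (p x < q x)%R & (0 <= a x)%R]).
Implicit Types (u f g h : X -> \bar R) (x : X).
Let Phi := double_phase p q a.
Let A := double_phase_energy p q a.

Let pqaE x : D x ->
  [/\ (1 < p x)%R, (1 < q x)%R, (0 <= a x)%R, (0 < p x)%R & (0 < q x)%R].
Proof. by move=> /pqa[p1 pq a0]; split => //; lra. Qed.

Lemma double_phaseE x xi : Phi x xi = two_power 1 (a x) (p x) (q x) xi.
Proof. by rewrite /two_power mul1e. Qed.

Lemma double_phase_energyE x xi :
  A x xi = two_power (p x)^-1 (a x / q x) (p x) (q x) xi.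
Proof. by []. Qed.

Lemma double_phase_ge0 x xi : D x -> 0 <= Phi x xi.
Proof. by move=> /pqaE[*]; rewrite double_phaseE two_power_ge0. Qed.

Lemma double_phase_energy_ge0 x xi : D x -> 0 <= A x xi.
Proof.
by move=> /pqaE[*]; rewrite two_power_ge0// ?divr_ge0 ?invr_ge0// ltW.
Qed.

Lemma measurable_double_phase u : mmeasurable_fun mu D u ->
  mmeasurable_fun mu D (fun x => Phi x `|u x|).
Proof.
move=> mu_u.
have -> : (fun x => Phi x `|u x|) = fun x => two_power 1 (a x) (p x) (q x) `|u x|.
  by apply/funext => x; rewrite double_phaseE.
apply: (@measurable_two_power _ _ (caratheodory_type mu)) => //.
- by move=> x /pqaE[].
- by move=> x /pqaE[].
- exact: (@measurableT_comp _ _ _ (caratheodory_type mu)).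
- by apply/measurable_EFinP; exact: measurable_cst.
Qed.

Lemma measurable_double_phase_energy g : mmeasurable_fun mu D g ->
  (forall x, D x -> 0 <= g x) -> mmeasurable_fun mu D (fun x => A x (g x)).
Proof.
have minv (r : X -> R) : (forall x, D x -> (0 < r x)%R) ->
    mmeasurable_fun mu D (EFin \o r) ->
    mmeasurable_fun mu D (EFin \o (fun x => (r x)^-1%R)).
  move=> r0 mr; apply: (@eq_measurable_fun _ _ (caratheodory_type mu) _ _
      (EFin \o (fun x => r x `^ (-1))%R)).
    by move=> x /set_mem Dx /=; rewrite powR_inv1// ltW// r0.
  apply/measurable_EFinP; apply: (measurableT_comp (measurable_powR _)).
  exact/measurable_EFinP.
move=> mg g0.
apply: (@measurable_two_power _ _ (caratheodory_type mu) _ _ (fun x => (p x)^-1)%R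
   (fun x => a x / q x)%R) => //.
- by move=> x /pqaE[].
- by move=> x /pqaE[].
- by apply: minv => // x /pqaE[].
- apply: (@eq_measurable_fun _ _ (caratheodory_type mu) _ _
    ((EFin \o a) \* (EFin \o (fun x => (q x)^-1)%R))); first by [].
  apply: (@emeasurable_funM _ (caratheodory_type mu)) => //.
  by apply: minv => // x /pqaE[].
Qed.

Lemma complementary_ge0 x xi : D x -> 0 <= complementary Phi x xi.
Proof.
move=> /pqaE[p1 q1 a0 p0 q0]; apply: ereal_sup_ubound; exists 0%R; first exact: lexx.
by rewrite mul0e double_phaseE two_power0// sube0.
Qed.

Lemma integrable_mul_complementary f u :
  in_LPhi mu D (complementary Phi) f -> in_LPhi mu D Phi u ->
  (cara_measure mu).-integrable D (fun x => f x * u x).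
Proof.
move=> [mf ffin] [mu_u ufin].
have mfu : mmeasurable_fun mu D (fun x => f x * u x).
  exact: (@emeasurable_funM _ (caratheodory_type mu)).
have mPu := measurable_double_phase mu_u.
pose k x := maxe 0 (`|f x * u x| - Phi x `|u x|).
have mk : mmeasurable_fun mu D k.
  apply: (@measurable_maxe _ (caratheodory_type mu)) => //.
  apply: (@emeasurable_funB _ (caratheodory_type mu)) => //.
  exact: (@measurableT_comp _ _ _ (caratheodory_type mu)).
have k0 x : 0 <= k x by rewrite /k le_max lexx.
(* Young's inequality; the majorant is not known to be measurable, which is why
   the truncated difference [k] is integrated instead. *)
have kle x : D x -> k x <= complementary Phi x `|f x|.
  move=> Dx; rewrite /k ge_max complementary_ge0//=.
  have [_ _ a0 p0 _] := pqaE Dx.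
  (* The supremum in [complementary] runs over real [s] only. Where [u] is infinite the subtracted
     term is [+oo], so the difference is [-oo] and the bound is trivial. *)
  have [uy|uny] := eqVneq `|u x| +oo.
    by rewrite uy double_phaseE two_power_pinfty// addeNy leNye.
  have ufx : `|u x| \is a fin_num by rewrite ge0_fin_numE// ltey.
  apply: ereal_sup_ubound; exists (fine `|u x|); first exact: fine_ge0.
  by rewrite fineK// abseM muleC.
have kint : \int[cara_measure mu]_(x in D) k x < +oo.
  by apply: le_lt_trans ffin; apply: ge0_le_lower_integral.
apply/integrableP; split => //.
apply: (@le_lt_trans _ _
    (\int[cara_measure mu]_(x in D) (k x + Phi x `|u x|))); last first.
  rewrite ge0_integralD//; last by move=> x Dx; exact: double_phase_ge0.
  by rewrite lte_add_pinfty.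
apply: ge0_le_integral => //.
- exact: (@measurableT_comp _ _ _ (caratheodory_type mu)).
- exact: (@emeasurable_funD _ (caratheodory_type mu)).
- move=> x Dx; have P0 := double_phase_ge0 `|u x| Dx.
  have [Py|Pny] := eqVneq (Phi x `|u x|) +oo.
    by rewrite Py addey ?leey// gt_eqF// (lt_le_trans ltNy0).
  have Pf : Phi x `|u x| \is a fin_num by rewrite ge0_fin_numE// ltey.
  by rewrite -leeBlDr// /k le_max lexx orbT.
Qed.

(** Because [p > 1], [|u|] is at most 1 plus its [p]-th power, hence at most [1 + Phi].
    Integrability makes the mean value additive, so the mean-zero constraint passes to midpoints. *)
Lemma in_LPhi_integrable u : mu D < +oo -> in_LPhi mu D Phi u ->
  (cara_measure mu).-integrable D u.
Proof.
move=> muD [mu_u ufin].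
have mPu := measurable_double_phase mu_u.
apply/integrableP; split => //.
apply: (@le_lt_trans _ _
    (\int[cara_measure mu]_(x in D) (1 + Phi x `|u x|))); last first.
  rewrite ge0_integralD//; last by move=> x Dx; exact: double_phase_ge0.
  by rewrite integral_cst// mul1e lte_add_pinfty.
apply: ge0_le_integral => //.
- exact: (@measurableT_comp _ _ _ (caratheodory_type mu)).
- by apply: (@emeasurable_funD _ (caratheodory_type mu)) => //; exact: measurable_cst.
- move=> x Dx; have [p1 q1 a0 p0 q0] := pqaE Dx.
  apply: (le_trans (le_1DpoweR (ltW p1) _)) => //; apply: leeD => //.
  by rewrite leeDl// mule_ge0// ?lee_fin// poweR_ge0.
Qed.

Lemma mmeasurable_midpoint u v : mmeasurable_fun mu D u ->
  mmeasurable_fun mu D v -> mmeasurable_fun mu D (midpoint u v).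
Proof.
move=> mu_u mv; apply: (@measurable_funeM _ (caratheodory_type mu)).
exact: (@emeasurable_funD _ (caratheodory_type mu)).
Qed.

(** Monotonicity and convexity of [Phi] bound the modular of the midpoint by the mean of the two
    modulars. *)
Lemma in_LPhi_midpoint u v : in_LPhi mu D Phi u -> in_LPhi mu D Phi v ->
  in_LPhi mu D Phi (midpoint u v).
Proof.
move=> [mu_u ufin] [mv vfin]; split; first exact: mmeasurable_midpoint.
have mPu := measurable_double_phase mu_u; have mPv := measurable_double_phase mv.
have P0 w x : D x -> 0 <= Phi x `|w x| by move=> Dx; exact: double_phase_ge0.
apply: (@le_lt_trans _ _ (\int[cara_measure mu]_(x in D)
    ((2^-1)%:E * (Phi x `|u x| + Phi x `|v x|)))).
  apply: ge0_le_lower_integral => [|x Dx]; first exact: P0.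
  have [p1 q1 a0 p0 q0] := pqaE Dx; rewrite !double_phaseE.
  apply: le_trans (two_power_midpoint_le _ a0 p1 q1 _ _) => //.
  by apply: two_power_le => //; [exact: ltW|exact: ltW|exact: abse_midpoint_le].
rewrite ge0_integralZl//.
- rewrite ge0_integralD//; [|exact: P0|exact: P0].
  by rewrite lte_mul_pinfty// lte_add_pinfty.
- exact: (@emeasurable_funD _ (caratheodory_type mu)).
- by move=> x Dx; rewrite adde_ge0 ?P0.
Qed.

(** The factors [1/p] and [1/q] are below 1, so the energy density is dominated by [Phi]. *)
Lemma energy_lty g : in_LPhi mu D Phi g -> (forall x, D x -> 0 <= g x) ->
  \int[cara_measure mu]_(x in D) A x (g x) < +oo.
Proof.
move=> [mg gfin] g0; apply: le_lt_trans gfin.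
apply: ge0_le_lower_integral => x Dx; first exact: double_phase_energy_ge0.
have [p1 q1 a0 p0 q0] := pqaE Dx; rewrite gee0_abs ?g0// double_phaseE.
rewrite double_phase_energyE.
have le1 (r : R) : (1 < r)%R -> (r^-1 <= 1)%R by move=> r1; rewrite invf_le1; lra.
apply: leeD; apply: lee_wpmul2r; rewrite ?poweR_ge0// lee_fin; first exact: le1.
by rewrite -[leRHS]mulr1 ler_wpM2l// le1.
Qed.

(** The hypothesis reverses the integrated convexity inequality. As convexity holds pointwise, the
    two integrands agree almost everywhere with finite value, and strict convexity applies at each
    such point. *)
Lemma energy_midpoint_eq g h : in_LPhi mu D Phi g -> in_LPhi mu D Phi h ->
  (forall x, D x -> 0 <= g x) -> (forall x, D x -> 0 <= h x) ->
  (2^-1)%:E * (\int[cara_measure mu]_(x in D) A x (g x) +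
               \int[cara_measure mu]_(x in D) A x (h x)) <=
    \int[cara_measure mu]_(x in D) A x (midpoint g h x) ->
  ae_on mu D (fun x => g x = h x).
Proof.
move=> Lg Lh g0 h0; have [mg _] := Lg; have [mh _] := Lh.
have mAg := measurable_double_phase_energy mg g0.
have mAh := measurable_double_phase_energy mh h0.
have A0 w x : D x -> 0 <= A x (w x) by move=> Dx; exact: double_phase_energy_ge0.
have m0 x : D x -> 0 <= midpoint g h x.
  by move=> Dx; rewrite mule_ge0 ?adde_ge0 ?g0 ?h0// lee_fin invr_ge0.
have mAm := measurable_double_phase_energy (mmeasurable_midpoint mg mh) m0.
pose G x := (2^-1)%:E * (A x (g x) + A x (h x)).
have half0 : 0 <= ((2^-1)%:E : \bar R) by rewrite lee_fin invr_ge0.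
have mG : mmeasurable_fun mu D G.
  apply: (@measurable_funeM _ (caratheodory_type mu)).
  exact: (@emeasurable_funD _ (caratheodory_type mu)).
have GE : \int[cara_measure mu]_(x in D) G x =
  (2^-1)%:E * (\int[cara_measure mu]_(x in D) A x (g x) +
               \int[cara_measure mu]_(x in D) A x (h x)).
  rewrite ge0_integralZl//.
  - by rewrite ge0_integralD//; exact: A0.
  - exact: (@emeasurable_funD _ (caratheodory_type mu)).
  - by move=> x Dx; rewrite adde_ge0 ?A0.
have Afacts x : D x ->
    [/\ (0 < (p x)^-1)%R, (0 <= a x / q x)%R, (1 < p x)%R & (1 < q x)%R].
  by move=> /pqaE[*]; split => //; rewrite ?invr_gt0// divr_ge0// ltW.
rewrite -GE => AG.
have : ae_on mu D (fun x => A x (midpoint g h x) = G x /\ G x \is a fin_num).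
  apply: integral_squeeze_ae_eq AG => //.
  - exact: A0.
  - move=> x Dx; have [b0 c0 p1 q1] := Afacts x Dx.
    by apply: two_power_midpoint_le => //; [exact: g0|exact: h0].
  - by rewrite GE lte_mul_pinfty// lte_add_pinfty// energy_lty.
apply: ae_onS => x Dx [e fin].
have [b0 c0 p1 q1] := Afacts x Dx.
exact: (two_power_midpoint_inj b0 c0 p1 q1 (g0 x Dx) (h0 x Dx) e fin).
Qed.

End phase.

(** * Modulus, weak upper gradients and midpoints in the Newtonian space *)

Section newtonian.
Context {R : realType} {X : completeMetricType R}
  (mu : {outer_measure set X -> \bar R}) (Om : set X) (p q a : X -> R).
Context (mu_regular : borel_regular mu) (oOm : open Om)
  (mp : mmeasurable_fun mu Om (EFin \o p)) (mq : mmeasurable_fun mu Om (EFin \o q))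
  (ma : mmeasurable_fun mu Om (EFin \o a))
  (pqa : forall x, Om x -> [/\ (1 < p x)%R, (p x < q x)%R & (0 <= a x)%R]).
Implicit Types (u v f g h : X -> \bar R) (x : X).
Let Phi := double_phase p q a.
Let A := double_phase_energy p q a.
Let mOm : mu.-caratheodory Om := open_caratheodory mu_regular oOm.

Lemma borel_fun_midpoint g h : borel_fun Om g -> borel_fun Om h ->
  borel_fun Om (midpoint g h).
Proof.
move=> bg bh; apply: (@measurable_funeM _ (g_sigma_algebraType (@open X))).
exact: (@emeasurable_funD _ (g_sigma_algebraType (@open X))).
Qed.

Lemma modulus_ge0 Gam : 0 <= modulus mu Om Phi Gam.
Proof.
apply: le_ereal_inf_tmp => _ [h [_ h0 _] <-]; apply: integral_ge0 => x Ox.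
exact: (double_phase_ge0 pqa).
Qed.

(** The maximum of two admissible functions is admissible for the union. Unlike their sum, it costs
    no constant: at each point [Phi] of the maximum is one of the two values, hence at most their
    sum. Each family contributes less than [e / 2]. *)
Lemma modulus_setU_eq0 Gam1 Gam2 :
  Gam1 `<=` rectifiable_curve_in Om -> Gam2 `<=` rectifiable_curve_in Om ->
  modulus mu Om Phi Gam1 = 0 -> modulus mu Om Phi Gam2 = 0 ->
  modulus mu Om Phi (Gam1 `|` Gam2) = 0.
Proof.
move=> rc1 rc2 m1 m2; apply/eqP; rewrite eq_le modulus_ge0 andbT.
apply/lee_addgt0Pr => e e0; rewrite add0e.
have adm Gam : modulus mu Om Phi Gam = 0 -> exists h, admissible Om Gam h /\
    mintegral mu Om (fun x => Phi x (h x)) < (e / 2)%:E.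
  move=> m0; have /ereal_inf_lt[_ [h ah <-] hlt] :
      modulus mu Om Phi Gam < (e / 2)%:E by rewrite m0 lte_fin divr_gt0.
  by exists h.
have [h1 [[b1 h10 l1] i1]] := adm _ m1; have [h2 [[b2 h20 l2] i2]] := adm _ m2.
have h0 x : Om x -> 0 <= maxe (h1 x) (h2 x) by move=> Ox; rewrite le_max h10.
have line_le c h : rectifiable_curve_in Om c -> (forall x, Om x -> 0 <= h x) ->
    (forall x, h x <= maxe (h1 x) (h2 x)) -> 1 <= line_integral c h ->
    1 <= line_integral c (fun x => maxe (h1 x) (h2 x)).
  move=> [_ _ _ cOm] hge0 hle /le_trans; apply; apply: ge0_le_lower_integral => t.
    by rewrite /= in_itv/= => /cOm /hge0.
  by move=> _; exact: hle.
have mPhi h : borel_fun Om h -> (forall x, Om x -> 0 <= h x) ->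
    mmeasurable_fun mu Om (fun x => Phi x (h x)).
  move=> bh hge0; have mh := borel_mmeasurable mu_regular oOm bh.
  apply: (@eq_measurable_fun _ _ (caratheodory_type mu) _ _ (fun x => Phi x `|h x|)).
    by move=> x /set_mem Ox; rewrite gee0_abs// hge0.
  exact: measurable_double_phase.
apply: (@le_trans _ _ (mintegral mu Om (fun x => Phi x (maxe (h1 x) (h2 x))))).
  apply: ereal_inf_lbound; exists (fun x => maxe (h1 x) (h2 x)) => //.
  split => //.
    exact: (@measurable_maxe _ (g_sigma_algebraType (@open X))).
  move=> c [/[dup] /rc1 rc /l1|/[dup] /rc2 rc /l2].
  - by apply: line_le => // x; rewrite le_max lexx.
  - by apply: line_le => // x; rewrite le_max lexx orbT.
apply: (@le_trans _ _ (mintegral mu Om (fun x => Phi x (h1 x) + Phi x (h2 x)))).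
  apply: ge0_le_lower_integral => x Ox; first exact: (double_phase_ge0 pqa).
  by case: (leP (h1 x) (h2 x)) => _; rewrite ?leeDl ?leeDr//;
     exact: (double_phase_ge0 pqa).
rewrite /mintegral ge0_integralD//; first last.
- exact: mPhi.
- by move=> x Ox; exact: (double_phase_ge0 pqa).
- exact: mPhi.
- by move=> x Ox; exact: (double_phase_ge0 pqa).
by rewrite [e]splitr EFinD; apply: leeD; apply: ltW.
Qed.

(** Off the union of the two exceptional families both gradient inequalities hold and can be
    averaged, line integrals being additive for nonnegative Borel functions. *)
Lemma weak_upper_gradient_midpoint u v g h :
  weak_upper_gradient mu Om Phi u g -> weak_upper_gradient mu Om Phi v h ->
  weak_upper_gradient mu Om Phi (midpoint u v) (midpoint g h).
Proof.
move=> [bg g0 [Gu [rcu mu0 ug]]] [bh h0 [Gv [rcv mv0 vh]]]; split.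
- exact: borel_fun_midpoint.
- by move=> x Ox; rewrite mule_ge0 ?adde_ge0 ?g0 ?h0// lee_fin invr_ge0.
exists (Gu `|` Gv); split.
- by move=> c [/rcu|/rcv].
- exact: modulus_setU_eq0.
move=> c rc /not_orP[nGu nGv].
rewrite (line_integral_midpoint oOm rc bg bh g0 h0).
apply: (le_trans (abse_midpoint_sub_le _ _ _ _)).
by rewrite lee_pmul2l// ?lte_fin ?invr_gt0// leeD ?ug ?vh.
Qed.

Lemma newtonian_midpoint u v : newtonian mu Om Phi u -> newtonian mu Om Phi v ->
  newtonian mu Om Phi (midpoint u v).
Proof.
move=> [Lu [g [ug Lg]]] [Lv [h [vh Lh]]]; split; first exact: in_LPhi_midpoint.
exists (midpoint g h); split; first exact: weak_upper_gradient_midpoint.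
exact: in_LPhi_midpoint.
Qed.

Lemma newtonian_mean0_midpoint u v : mu Om < +oo ->
  newtonian_mean0 mu Om Phi u -> newtonian_mean0 mu Om Phi v ->
  newtonian_mean0 mu Om Phi (midpoint u v).
Proof.
move=> muOm [Nu u0] [Nv v0]; split; first exact: newtonian_midpoint.
have iu : (cara_measure mu).-integrable Om u.
  by case: Nu => Lu _; exact: (in_LPhi_integrable _ _ _ _ _ _ Lu).
have iv : (cara_measure mu).-integrable Om v.
  by case: Nv => Lv _; exact: (in_LPhi_integrable _ _ _ _ _ _ Lv).
have mO : measurable (Om : set (caratheodory_type mu)) by exact: mOm.
rewrite /mintegral (integralZl mO (integrableD mO iu iv)).
by rewrite (integralD mO iu iv) [X in X + _]u0 [X in _ + X]v0 adde0 mule0.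
Qed.

Lemma min_gradient_minimal u g : minimal_weak_upper_gradient mu Om Phi u g ->
  minimal_weak_upper_gradient mu Om Phi u (min_gradient mu Om Phi u).
Proof. exact: xgetI. Qed.

(* When no minimal gradient exists [min_gradient] is the constant 0, and the
   bound holds all the same. *)
Lemma min_gradient_le u g : weak_upper_gradient mu Om Phi u g ->
  in_LPhi mu Om Phi g ->
  [/\ mmeasurable_fun mu Om (min_gradient mu Om Phi u),
      forall x, Om x -> 0 <= min_gradient mu Om Phi u x &
      ae_on mu Om (fun x => min_gradient mu Om Phi u x <= g x)].
Proof.
move=> ug Lg; have [_ g0 _] := ug.
rewrite /min_gradient; case: xgetP => [h _ [[_ h0 _] [mh _] hmin]|_].
  by split => //; exact: hmin.
split => //; first exact: measurable_cst.
apply: (@filterS _ _ (ae_on_filter mu) setT) => [x _|]; first exact: g0.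
exact: (@filterT _ _ (ae_on_filter mu)).
Qed.

Lemma minimal_weak_upper_gradient_ae_eq u g h :
  minimal_weak_upper_gradient mu Om Phi u g ->
  minimal_weak_upper_gradient mu Om Phi u h ->
  ae_on mu Om (fun x => g x = h x).
Proof.
move=> [ug Lg ming] [uh Lh minh].
apply: ae_onS (ae_onI (ming _ uh Lh) (minh _ ug Lg)) => x _ [gh hg].
by apply/eqP; rewrite eq_le gh.
Qed.

(** The midpoint of [g] and [h] competes in the minimality of the gradient of [midpoint u v]; the
    resulting almost everywhere bound passes to energies because the density is increasing. *)
Lemma energy_min_gradient_midpoint_le u v g h :
  weak_upper_gradient mu Om Phi u g -> weak_upper_gradient mu Om Phi v h ->
  in_LPhi mu Om Phi g -> in_LPhi mu Om Phi h ->
  mintegral mu Om (fun x => A x (min_gradient mu Om Phi (midpoint u v) x)) <=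
  mintegral mu Om (fun x => A x (midpoint g h x)).
Proof.
move=> ug vh Lg Lh; have wgh := weak_upper_gradient_midpoint ug vh.
have Lgh : in_LPhi mu Om Phi (midpoint g h) by exact: in_LPhi_midpoint.
have [mm m0 mle] := min_gradient_le wgh Lgh.
have [_ gh0 _] := wgh; have [mgh _] := Lgh.
apply: ae_ge0_le_integral => //.
- by move=> x Ox; exact: (double_phase_energy_ge0 pqa).
- exact: measurable_double_phase_energy.
- by move=> x Ox; exact: (double_phase_energy_ge0 pqa).
- exact: measurable_double_phase_energy.
apply: ae_onS mle => x Ox le_m; have [p1 pq a0] := pqa Ox.
by apply: two_power_le => //; rewrite ?divr_ge0 ?invr_ge0 ?m0//; lra.
Qed.

End newtonian.

(** * Linearity of the trace and of the boundary term *)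

Section trace.
Context {R : realType} {X : completeMetricType R}
  (mu nu : {outer_measure set X -> \bar R}) (Om : set X)
  (Phi : X -> \bar R -> \bar R) (T : (X -> \bar R) -> X -> \bar R).
Context (hT : trace_operator mu Om Phi nu T).

(* [2 * w = u + v] for the midpoint [w] of [u] and [v], which avoids the
   homogeneity of T. *)
Lemma trace_midpoint u v : newtonian mu Om Phi u -> newtonian mu Om Phi v ->
  newtonian mu Om Phi (midpoint u v) ->
  ae_on nu (frontier Om)
    (fun z => T (midpoint u v) z + T (midpoint u v) z = T u z + T v z).
Proof.
case: hT => _ Tlin _ _ Nu Nv Nw.
have Tw := Tlin 1%R _ _ Nw Nw; have Tuv := Tlin 1%R _ _ Nu Nv.
apply: ae_onS (ae_onI Tw Tuv) => z _; rewrite !mul1e => -[<- <-].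
by congr (T _ z); apply/funext => x; rewrite !mul1e half_add.
Qed.

Lemma boundary_term_midpoint (f u v : X -> \bar R) :
  nu.-caratheodory (frontier Om) ->
  (forall w, newtonian mu Om Phi w ->
     (cara_measure nu).-integrable (frontier Om) (fun z => f z * T w z)) ->
  newtonian mu Om Phi u -> newtonian mu Om Phi v ->
  newtonian mu Om Phi (midpoint u v) ->
  mintegral nu (frontier Om) (fun z => f z * T (midpoint u v) z) +
  mintegral nu (frontier Om) (fun z => f z * T (midpoint u v) z) =
  mintegral nu (frontier Om) (fun z => f z * T u z) +
  mintegral nu (frontier Om) (fun z => f z * T v z).
Proof.
move=> cF int Nu Nv Nw.
have mF : measurable (frontier Om : set (caratheodory_type nu)) by exact: cF.
have iu := int _ Nu; have iv := int _ Nv; have iw := int _ Nw.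
rewrite /mintegral -(integralD mF iw iw) -(integralD mF iu iv).
apply: ae_eq_integral => //.
- exact: (measurable_int _ (integrableD mF iw iw)).
- exact: (measurable_int _ (integrableD mF iu iv)).
(* Integrable products are finite almost everywhere, which is what multiplying the trace identity by
   the possibly infinite [f] requires. *)
have fu : ae_on nu (frontier Om) (fun z => f z * T u z \is a fin_num).
  exact: integrable_ae iu.
have fv : ae_on nu (frontier Om) (fun z => f z * T v z \is a fin_num).
  exact: integrable_ae iv.
have fw : ae_on nu (frontier Om) (fun z => f z * T (midpoint u v) z \is a fin_num).
  exact: integrable_ae iw.
apply: ae_onS (ae_onI (trace_midpoint Nu Nv Nw) (ae_onI fu (ae_onI fv fw))).
by move=> z _ [e [xf [yf wf]]]; exact: mule_double_eq.
Qed.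

End trace.

Theorem theorem4p3 (R : realType) (X : completeMetricType R)
    (mu nu : {outer_measure set X -> \bar R}) (Om : set X)
    (theta : R) (p q a : X -> R) (T : (X -> \bar R) -> X -> \bar R)
    (f : X -> \bar R)
    (hmu_regular : borel_regular mu)
    (hmu_sfinite : sigma_finite_outer mu)
    (hmu_ball : forall (x : X) (r : R), (0 < r)%R -> 0 < mu (ball x r) < +oo)
    (hOm_domain : domain Om)
    (hOm_ball : forall (x : X) (r : R), closure Om x -> (0 < r)%R ->
       0 < mu (ball x r `&` Om) < +oo)
    (hOm_doubling : restricted_doubling mu Om)
    (hnu_regular : borel_regular nu)
    (hnu_sfinite : sigma_finite_outer nu)
    (hnu_frontier : nu (~` frontier Om) = 0)
    (htheta : (0 <= theta < 1)%R)
    (hnu_codim : upper_codimension mu nu Om theta)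
    (hphase_mu : double_phase_data mu (closure Om) p q a)
    (hphase_nu : double_phase_data nu (frontier Om) p q a)
    (hOm_bounded : metric_bounded Om)
    (hcomparable : local_comparability (closure Om) (double_phase p q a))
    (hpoincare : weak_poincare mu Om (double_phase p q a))
    (hT : trace_operator mu Om (double_phase p q a) nu T)
    (hf : in_LPhi nu (frontier Om) (complementary (double_phase p q a)) f)
    (hf_mean : mintegral nu (frontier Om) f = 0) :
  let J := energy_functional mu Om (double_phase p q a) nu
             (double_phase_energy p q a) T f in
  forall u v : X -> \bar R,
  minimizers mu Om (double_phase p q a) J u ->
  minimizers mu Om (double_phase p q a) J v ->
  forall g_u g_v : X -> \bar R,
  minimal_weak_upper_gradient mu Om (double_phase p q a) u g_u ->
  minimal_weak_upper_gradient mu Om (double_phase p q a) v g_v ->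
  ae_on mu Om (fun x => g_u x = g_v x).
Proof.
move=> J u v [Mu Ju] [Mv Jv] g_u g_v min_u min_v.
have [oOm _ [x0 Omx0]] := hOm_domain.
have cOm := open_caratheodory hmu_regular oOm.
have cF := frontier_caratheodory Om hnu_regular.
have ccl : mu.-caratheodory (closure Om).
  rewrite -(setCK (closure Om)); apply: (@measurableC _ (caratheodory_type mu)).
  apply: (open_caratheodory hmu_regular); apply: closed_openC.
  exact: closed_closure.
have [[mp mq ma] pqa _ _ _] := hphase_mu.
have [[np nq na] pqaF _ _ _] := hphase_nu.
have pqaO x : Om x -> [/\ (1 < p x)%R, (p x < q x)%R & (0 <= a x)%R].
  by move=> /(@subset_closure _ Om) /pqa.
have toOm w : mmeasurable_fun mu (closure Om) w -> mmeasurable_fun mu Om w.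
  by apply: (@measurable_funS _ _ (caratheodory_type mu)) => //; exact: subset_closure.
have {}mp := toOm _ mp; have {}mq := toOm _ mq; have {}ma := toOm _ ma.
have muOm : mu Om < +oo.
  have [x [r Or]] := hOm_bounded.
  (* The radius given by [metric_bounded] may fail to be positive, whereas finiteness of the measure
     is assumed for positive radii. *)
  have r0 : (0 < Num.max r 1)%R by rewrite lt_max ltr01 orbT.
  case/andP: (hmu_ball x _ r0) => _; apply: le_lt_trans; apply: le_outer_measure.
  by apply: subset_trans Or _; apply: le_ball; rewrite le_max lexx.
have Mw := newtonian_mean0_midpoint hmu_regular oOm mp mq ma pqaO muOm Mu Mv.
have [[Nu _] [[Nv _] [Nw _]]] := (Mu, (Mv, Mw)).
have Tint w : newtonian mu Om (double_phase p q a) w ->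
    (cara_measure nu).-integrable (frontier Om) (fun z => f z * T w z).
  case: hT => TL _ _ _ /TL TLw.
  exact: (integrable_mul_complementary cF np nq na pqaF hf TLw).
have Lw := boundary_term_midpoint hT cF Tint Nu Nv Nw.
have Lfin w : newtonian mu Om (double_phase p q a) w ->
    mintegral nu (frontier Om) (fun z => f z * T w z) \is a fin_num.
  by move=> /Tint; exact: integrable_fin_num.
have Jw : ereal_inf (J @` newtonian_mean0 mu Om (double_phase p q a)) <=
    J (midpoint u v) by apply: ereal_inf_lbound; exists (midpoint u v).
(* The functional is written with the chosen [min_gradient], while [g_u] and [g_v] are arbitrary
   minimal gradients. Equality is shown for the chosen ones and transferred at the end by almost
   everywhere uniqueness. *)
have gmin_u := min_gradient_minimal min_u.
have gmin_v := min_gradient_minimal min_v.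
have [ug Lg _] := gmin_u; have [vh Lh _] := gmin_v.
have [_ g0 _] := ug; have [_ h0 _] := vh.
have Ele := energy_min_gradient_midpoint_le hmu_regular oOm mp mq ma pqaO ug vh Lg Lh.
have eq_gh : ae_on mu Om (fun x => min_gradient mu Om (double_phase p q a) u x =
                         min_gradient mu Om (double_phase p q a) v x).
  apply: (energy_midpoint_eq cOm mp mq ma pqaO Lg Lh g0 h0).
  apply: le_trans Ele.
  have Eu := energy_lty pqaO Lg g0; have Ev := energy_lty pqaO Lh h0.
  have E0 w : newtonian mu Om (double_phase p q a) w -> 0 <= mintegral mu Om
      (fun x => double_phase_energy p q a x (min_gradient mu Om (double_phase p q a) w x)).
    move=> [_ [g [wg Lgw]]]; have [_ m0 _] := min_gradient_le wg Lgw.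
    by apply: integral_ge0 => x Ox; exact: (double_phase_energy_ge0 pqaO).
  exact: (convex_comparison (E0 _ Nu) (E0 _ Nv) (E0 _ Nw) Eu Ev (Lfin _ Nu)
    (Lfin _ Nv) (Lfin _ Nw) Lw Ju Jv Jw).
have eu := minimal_weak_upper_gradient_ae_eq min_u gmin_u.
have ev := minimal_weak_upper_gradient_ae_eq min_v gmin_v.
by apply: ae_onS (ae_onI eq_gh (ae_onI eu ev)) => x _ [-> [-> ->]].
Qed.
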